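(* Let $r\ge 1$ and $d\ge 1$, and let $S_{d,r}$ denote the free solvable group of class $d$ and rank $r$. The Magnus embedding $\phi: S_{d,r}\hookrightarrow \mathbb{Z}^r\wr S_{d-1,r}$ is a quasi-isometry onto its image, i.e. a quasi-isometric embedding: there exist constants $\lambda\ge 1$ and $C\ge 0$ such that for all $g,h\in S_{d,r}$, $$\frac1\lambda\,\|g^{-1}h\|_{S_{d,r}}-C\;\le\;\|\phi(g)^{-1}\phi(h)\|_{\mathbb{Z}^r\wr S_{d-1,r}}\;\le\;\lambda\,\|g^{-1}h\|_{S_{d,r}}+C.$$
   Context: Let $F=\langle x_1,\ldots,x_r\rangle$ be the free group of rank $r$, with derived series $F^{(0)}=F$, $F^{(n+1)}=[F^{(n)},F^{(n)}]$. Then $S_{d,r}=F/F^{(d)}$ (so $S_{0,r}$ is trivial). With $N=F^{(d-1)}$ one has $N'=[N,N]=F^{(d)}$, so $S_{d,r}=F/N'$ and $S_{d-1,r}=F/N$. Write $B=F/N=S_{d-1,r}$ and let $A=\mathbb{Z}^r$ be free abelian (written multiplicatively) with basis $\{a_1,\ldots,a_r\}$. The symbol $x_i$ also denotes the image of $x_i$ in $F/N'$ and in $F/N$, and $\bar{\ }$ denotes the canonical epimorphism onto $F/N$ (from $F$ or from $F/N'$), extended linearly to group rings. Wreath product: $A^{(B)}$ is the group of finitely supported functions $B\to A$ under pointwise multiplication, and $A\wr B=B\ltimes A^{(B)}$, where $b\in B$ acts on $f\in A^{(B)}$ by $f^b(x)=f(xb^{-1})$, i.e. $f^b=b^{-1}fb$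 in $A\wr B$. $A$ is embedded in $A\wr B$ by identifying $a\in A$ with the function taking the value $a$ at $1_B$ and $1$ elsewhere; $B$ is embedded as the complement. For $a\in A$ and $\alpha=\sum_{b\in B}u_b b\in\mathbb{Z}[B]$, $a^{\alpha}$ denotes $\prod_{b\in B}(a^{u_b})^b\in A^{(B)}$. Magnus embedding: $\phi: F/N'\to A\wr B$ is the injective homomorphism $$\phi(g)=\overline{g}\cdot a_1^{\overline{\partial g/\partial x_1}}\cdots a_r^{\overline{\partial g/\partial x_r}},$$ where $\partial/\partial x_i$ is the Fox derivative with respect to $x_i$, evaluated on any word in $F$ representing $g$, with $\partial x_j/\partial x_i=\delta_{ij}$ and the convention $\partial(gh)/\partial x_i=(\partial g/\partial x_i)\,h+\partial h/\partial x_i$. Equivalently, $\phi$ is the homomorphism determined by $\phi(x_i)=x_i a_i$ for $i=1,\ldots,r$. Lengths: $\|g\|_G$ is the word length of $g$ in $G$, with respect to the generating sets $\{x_1,\ldots,x_r\}$ for $S_{d,r}$ and $\{x_1,\ldots,x_r\}\cup\{a_1,\ldots,a_r\}$ for $\mathbb{Z}^r\wr S_{d-1,r}$. *)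

(* Defs.v *)
From HB Require Import structures.
From mathcomp Require Import all_boot all_order all_algebra.
From mathcomp Require Import finmap monalg.
From mathcomp Require Import boolp classical_sets reals.

Set Implicit Arguments.
Unset Strict Implicit.
Unset Printing Implicit Defensive.

Import GRing.Theory.

Local Open Scope classical_set_scope.
Local Open Scope group_scope.
Local Open Scope quotient_scope.

Section Subgroups.
Variable G : groupType.
Implicit Types (H K : set G) (x y : G).

Definition is_subgroup H : Prop :=
  H 1 /\ forall x y, H x -> H y -> H (x / y).

Definition normal_subgroup H : Prop :=
  is_subgroup H /\ forall x y, H x -> H (x ^ y).

Definition generated (X : set G) : set G := smallest is_subgroup X.

(* Mathcomp's [~ x, y] is x^-1 y^-1 x y. *)
Definition commutator H K : set G :=
  generated [set z | exists2 x, H x & exists2 y, K y & z = [~ x, y]].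

Fixpoint derived (n : nat) : set G :=
  if n is n'.+1 then commutator (derived n') (derived n') else [set: G].

Lemma subgroupV H x : is_subgroup H -> H x -> H x^-1.
Proof. by case=> H1 HF Hx; rewrite -div1g; apply: HF. Qed.

Lemma subgroupM H x y : is_subgroup H -> H x -> H y -> H (x * y).
Proof.
move=> sH Hx Hy; rewrite -[y]invgK; apply: sH.2 => //; exact: subgroupV.
Qed.

Lemma generated_subgroup X : is_subgroup (generated X).
Proof.
split=> [H [[]] //|x y Xx Xy H [sH XH]].
by apply: sH.2; [apply: Xx|apply: Xy].
Qed.

Lemma commutator_normal H K :
  normal_subgroup H -> normal_subgroup K -> normal_subgroup (commutator H K).
Proof.
move=> [sH nH] [sK nK]; split=> [|x y]; first exact: generated_subgroup.
have sC := generated_subgroup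
  [set z | exists2 x, H x & exists2 y, K y & z = [~ x, y]].
suff: commutator H K `<=` [set x | commutator H K (x ^ y)] by apply.
apply: smallest_sub => [|z [u Hu [v Kv ->]]] /=.
  split=> [|u v /= Cu Cv]; first by rewrite /= conj1g; apply: sC.1.
  by rewrite conjMg conjVg; apply: sC.2.
rewrite conjRg; apply: sub_gen_smallest.
by exists (u ^ y); [exact: nH|exists (v ^ y); [exact: nK|]].
Qed.

Lemma derived_normal n : normal_subgroup (derived n).
Proof. by elim: n => [|n IHn] /=; [do !split|exact: commutator_normal]. Qed.

Lemma derivedS n : 0 < n ->
  derived n = commutator (derived n.-1) (derived n.-1).
Proof. by case: n. Qed.

End Subgroups.

Section Quotient.
Variables (G : groupType) (N : set G) (nN : normal_subgroup N).
Implicit Types x y z : G.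

Definition coset_rel : rel G := fun x y => `[< N (x^-1 * y) >].

Lemma coset_equiv : equiv_class_of coset_rel.
Proof.
have [sN _] := nN; split=> [x|x y|y x z].
- by apply/asboolP; rewrite mulVg; apply: sN.1.
- by apply/asboolP/asboolP => /(subgroupV sN); rewrite invgM invgK.
- move=> /asboolP Nxy /asboolP Nyz; apply/asboolP.
  by rewrite -(mulVKg y z) mulgA; apply: subgroupM.
Qed.

Canonical coset_equiv_rel := EquivRelPack coset_equiv.

Definition quotient : Type := {eq_quot coset_equiv_rel}.
HB.instance Definition _ := Choice.on quotient.
HB.instance Definition _ := EqQuotient.on quotient.

Definition proj (x : G) : quotient := \pi x.

Lemma projP x y : proj x = proj y <-> N (x^-1 * y).
Proof.
rewrite /proj; split=> [/eqmodP/asboolP //|Nxy].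
exact/eqmodP/asboolP.
Qed.

Definition quot_one : quotient := proj 1.
Definition quot_mul (a b : quotient) : quotient := proj (repr a * repr b).
Definition quot_inv (a : quotient) : quotient := proj (repr a)^-1.

Lemma proj_repr a : proj (repr a) = a.
Proof. exact: reprK. Qed.

Lemma proj_mul x y : proj (x * y) = quot_mul (proj x) (proj y).
Proof.
have [sN cN] := nN; apply/projP.
have /projP Nx : proj x = proj (repr (proj x)) by rewrite proj_repr.
have /projP Ny : proj y = proj (repr (proj y)) by rewrite proj_repr.
move: (repr _) (repr _) Nx Ny => x' y' Nx Ny.
have -> : (x * y)^-1 * (y' * x') = (x^-1 * y') ^ y * (y^-1 * x').
  by rewrite conjgE invgM !mulgA mulgK.
by apply: subgroupM => //; apply: cN.
Qed.

Lemma proj_inv x : proj x^-1 = quot_inv (proj x).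
Proof.
have [sN cN] := nN; apply/projP.
have /projP Nx : proj (repr (proj x)) = proj x by rewrite proj_repr.
move: (repr _) Nx => x' Nx.
have -> : x^-1^-1 * x'^-1 = (x'^-1 * x) ^ x'^-1.
  by rewrite conjgE !invgK !mulgA mulgV mul1g.
exact: cN.
Qed.

Lemma quot_mulA : associative quot_mul.
Proof.
by move=> a b c; rewrite -[a]proj_repr -[b]proj_repr -[c]proj_repr
  -!proj_mul mulgA.
Qed.

Lemma quot_mul1 : left_id quot_one quot_mul.
Proof. by move=> a; rewrite -[a]proj_repr -proj_mul mul1g. Qed.

Lemma quot_1mul : right_id quot_one quot_mul.
Proof. by move=> a; rewrite -[a]proj_repr -proj_mul mulg1. Qed.

Lemma quot_mulV : left_inverse quot_one quot_inv quot_mul.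
Proof. by move=> a; rewrite -[a]proj_repr -proj_inv -proj_mul mulVg. Qed.

Lemma quot_Vmul : right_inverse quot_one quot_inv quot_mul.
Proof. by move=> a; rewrite -[a]proj_repr -proj_inv -proj_mul mulgV. Qed.

HB.instance Definition _ := isGroup.Build quotient
  quot_mulA quot_mul1 quot_1mul quot_mulV quot_Vmul.

Lemma projM : {morph proj : x y / x * y}.
Proof. exact: proj_mul. Qed.

End Quotient.

(* The letter (i, false) stands for x_i and (i, true) for x_i^-1; an element   *)
(* of the free group is a reduced word.                                        *)
Definition letter (r : nat) := ('I_r * bool)%type.

Definition linv r (l : letter r) : letter r := (l.1, ~~ l.2).

Definition reduced r : pred (seq (letter r)) :=
  sorted [rel l m | m != linv l].

Definition push r (l : letter r) (w : seq (letter r)) :=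
  if w is m :: w' then if m == linv l then w' else l :: w else [:: l].

Record free_group (r : nat) := FreeGroup {
  fword :> seq (letter r);
  fwordP : reduced fword
}.

HB.instance Definition _ r := [isSub for @fword r].
HB.instance Definition _ r := [Choice of free_group r by <:].

Section FreeGroup.
Variable r : nat.
Implicit Types (l : letter r) (s w : seq (letter r)) (u v : free_group r).

Lemma linvK : involutive (@linv r).
Proof. by case=> i b; rewrite /linv negbK. Qed.

Lemma reduced_cons l s : reduced (l :: s) -> reduced s.
Proof. exact: path_sorted. Qed.

Lemma push_reduced l s : reduced s -> reduced (push l s).
Proof.
case: s => [|m s] //= rs; case: ifPn => [_|ml]; first exact: reduced_cons rs.
by rewrite /reduced /= ml.
Qed.

Lemma push_id l s : reduced (l :: s) -> push l s = l :: s.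
Proof. by case: s => [|m s] //= /andP[/negPf -> _]. Qed.

Lemma pushK l s : reduced s -> push (linv l) (push l s) = s.
Proof.
case: s => [|m s] /= rs; first by rewrite linvK eqxx.
case: eqP => [ml|_]; last by rewrite /= linvK eqxx.
by rewrite -ml push_id.
Qed.

Lemma foldr_push_reduced s w : reduced s -> reduced (foldr (@push r) s w).
Proof. by move=> rs; elim: w => //= l w IHw; apply: push_reduced. Qed.

Lemma foldr_push_id w : reduced w -> foldr (@push r) [::] w = w.
Proof.
elim: w => //= l w IHw rw; rewrite IHw ?push_id //; exact: reduced_cons rw.
Qed.

Lemma foldr_push_push l s w : reduced s -> reduced w ->
  foldr (@push r) s (push l w) = push l (foldr (@push r) s w).
Proof.
case: w => [|m w] //= rs rw; case: eqP => [->|//] /=.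
by rewrite -{1}(pushK (linv l) (foldr_push_reduced w rs)) linvK.
Qed.

Lemma foldr_push_foldr s w1 w2 : reduced s -> reduced w2 ->
  foldr (@push r) s (foldr (@push r) w2 w1) =
  foldr (@push r) (foldr (@push r) s w2) w1.
Proof.
move=> rs rw2; elim: w1 => //= l w1 IHw.
by rewrite foldr_push_push ?IHw // foldr_push_reduced.
Qed.

Definition free_one : free_group r := @FreeGroup r [::] isT.

Definition free_mul u v : free_group r :=
  FreeGroup (foldr_push_reduced u (fwordP v)).

Lemma free_inv_subproof u : reduced (rev (map (@linv r) u)).
Proof.
rewrite /reduced rev_sorted sorted_map; move: (fwordP u).
apply: sub_sorted => l m /=; apply: contra => /eqP ->.
by rewrite linvK.
Qed.

Definition free_inv u : free_group r := FreeGroup (free_inv_subproof u).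

Lemma free_mulA : associative free_mul.
Proof.
move=> u v w; apply: val_inj => /=.
by rewrite foldr_push_foldr ?fwordP.
Qed.

Lemma free_mul1 : left_id free_one free_mul.
Proof. by move=> u; apply: val_inj. Qed.

Lemma free_1mul : right_id free_one free_mul.
Proof. by move=> u; apply: val_inj; rewrite /= foldr_push_id ?fwordP. Qed.

Lemma free_mulV : left_inverse free_one free_inv free_mul.
Proof.
case=> w rw; apply: val_inj => /=; elim: w rw => //= l w IHw rw.
by rewrite rev_cons foldr_rcons /= linvK eqxx IHw // (reduced_cons rw).
Qed.

Lemma free_invK : involutive free_inv.
Proof.
by move=> u; apply: val_inj; rewrite /= map_rev revK mapK //; exact: linvK.
Qed.

Lemma free_Vmul : right_inverse free_one free_inv free_mul.
Proof. by move=> u; rewrite -{1}[u]free_invK free_mulV. Qed.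

HB.instance Definition _ := isGroup.Build (free_group r)
  free_mulA free_mul1 free_1mul free_mulV free_Vmul.

Definition free_letter l : free_group r := @FreeGroup r [:: l] isT.

Definition free_gen (i : 'I_r) : free_group r := free_letter (i, false).

Definition of_word w : free_group r := \prod_(l <- w) free_letter l.

Lemma of_word_fword u : of_word u = u.
Proof.
apply: val_inj; rewrite /of_word /=; case: u => w rw /=; elim: w rw => /= [|l w IHw] rw.
  by rewrite big_nil.
by rewrite big_cons /= IHw ?push_id // (reduced_cons rw).
Qed.

Lemma free_letterV l : free_letter (linv l) = (free_letter l)^-1.
Proof. by apply: val_inj. Qed.

Lemma push_of_word l w : of_word (push l w) = of_word (l :: w).
Proof.
rewrite /of_word big_cons; case: w => [|m w] /=; first by rewrite big_seq1 big_nil mulg1.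
by case: eqP => [->|_]; rewrite !big_cons // free_letterV mulVKg.
Qed.

End FreeGroup.

(* {malg V[K]} is the type of finitely supported functions from K to V; for    *)
(* V = int it is the additive group of the group ring Z[K], and for V = A,     *)
(* K = B it is A^(B), the group A being written additively.                    *)
Section FinitelySupported.
Local Open Scope ring_scope.

Lemma malg_ind (K : choiceType) (V : zmodType) (P : {malg V[K]} -> Prop) :
    P 0 -> (forall f g, P f -> P g -> P (f + g)) ->
    (forall k v, P << v *g k >>) ->
  forall f, P f.
Proof. by move=> P0 PD PU f; rewrite (monalgE f); apply: big_ind. Qed.

Section Sum.
Variables (K : choiceType) (V W : zmodType) (h : K -> V -> W).
Hypotheses (h0 : forall k, h k 0 = 0).
Hypotheses (hD : forall k, {morph h k : x y / x + y}).

Lemma sum_msupp_incl (d : {fset K}) (f : {malg V[K]}) : (msupp f `<=` d)%fset ->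
  \sum_(k <- msupp f) h k f@_k = \sum_(k <- d) h k f@_k.
Proof.
move=> sd; apply: big_fset_incl => //= k _ kf.
by rewrite mcoeff_outdom // h0.
Qed.

Lemma sum_msuppD (f g : {malg V[K]}) :
  \sum_(k <- msupp (f + g)) h k (f + g)@_k =
  \sum_(k <- msupp f) h k f@_k + \sum_(k <- msupp g) h k g@_k.
Proof.
rewrite (sum_msupp_incl (msuppD_le f g)).
rewrite (sum_msupp_incl (fsubsetUl (msupp f) (msupp g))).
rewrite (sum_msupp_incl (fsubsetUr (msupp f) (msupp g))) -big_split /=.
by apply: eq_bigr => k _; rewrite mcoeffD hD.
Qed.

Lemma sum_msuppU k v :
  \sum_(k' <- msupp << v *g k >>) h k' << v *g k >>@_k' = h k v.
Proof.
by rewrite (sum_msupp_incl msuppU_le) big_seq_fset1 mcoeffUU.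
Qed.

Lemma sum_msupp0 : \sum_(k <- msupp (0 : {malg V[K]})) h k 0@_k = 0.
Proof. by rewrite msupp0 big_seq_fset0. Qed.

End Sum.

Section Translation.
Variables (B : groupType) (V : zmodType).
Implicit Types (b c : B) (f g : {malg V[B]}).

(* f^b : x |-> f (x b^-1); in Z[B] this is the right multiplication by b. *)
Definition rtrans b f : {malg V[B]} :=
  [malg x in [fset (k * b)%g | k in msupp f]%fset => f@_(x * b^-1)%g].

Lemma rtransE b f x : (rtrans b f)@_x = f@_(x * b^-1)%g.
Proof.
rewrite mcoeffE; case: ifPn => // xf; rewrite mcoeff_outdom //.
apply: contra xf => xf; apply/imfsetP; exists (x * b^-1)%g => //=.
by rewrite mulgVK.
Qed.

Lemma rtransD b : {morph rtrans b : f g / f + g}.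
Proof. by move=> f g; apply/malgP => x; rewrite !(rtransE, mcoeffD). Qed.

Lemma rtrans0 b : rtrans b 0 = 0.
Proof. by apply/malgP => x; rewrite rtransE !mcoeff0. Qed.

Lemma rtransN b f : rtrans b (- f) = - rtrans b f.
Proof. by apply/malgP => x; rewrite !(rtransE, mcoeffN). Qed.

Lemma rtransM b c f : rtrans (b * c)%g f = rtrans c (rtrans b f).
Proof. by apply/malgP => x; rewrite !rtransE invgM mulgA. Qed.

Lemma rtrans1 f : rtrans 1%g f = f.
Proof. by apply/malgP => x; rewrite rtransE invg1 mulg1. Qed.

Lemma rtransU b k v : rtrans b << v *g k >> = << v *g (k * b)%g >>.
Proof. by apply/malgP => x; rewrite rtransE !mcoeffU eq_sym divg_eq eq_sym.
Qed.

End Translation.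

End FinitelySupported.

Definition wreath (A : zmodType) (B : groupType) : Type := (B * {malg A[B]})%type.
HB.instance Definition _ A B := Choice.on (wreath A B).

(* The pair (b, f) stands for b f; since f c = c f^c, one has                  *)
(* (b f)(c g) = (b c)(f^c + g).                                                *)
Section Wreath.
Variables (A : zmodType) (B : groupType).
Implicit Types p q : wreath A B.

Definition wr_one : wreath A B := (1, 0%R).
Definition wr_mul p q : wreath A B := ((p.1 * q.1)%g, rtrans q.1 p.2 + q.2)%R.
Definition wr_inv p : wreath A B := ((p.1^-1)%g, - rtrans (p.1^-1)%g p.2)%R.

Lemma wr_mulA : associative wr_mul.
Proof.
by move=> p q s; rewrite /wr_mul /= mulgA rtransD rtransM addrA.
Qed.

Lemma wr_mul1 : left_id wr_one wr_mul.
Proof. by case=> b f; rewrite /wr_mul /= mul1g rtrans0 add0r. Qed.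

Lemma wr_1mul : right_id wr_one wr_mul.
Proof. by case=> b f; rewrite /wr_mul /= mulg1 rtrans1 addr0. Qed.

Lemma wr_mulV : left_inverse wr_one wr_inv wr_mul.
Proof.
case=> b f; rewrite /wr_mul /wr_inv /= mulVg rtransN -rtransM mulVg rtrans1.
by rewrite addNr.
Qed.

Lemma wr_Vmul : right_inverse wr_one wr_inv wr_mul.
Proof. by case=> b f; rewrite /wr_mul /wr_inv /= mulgV addrN. Qed.

HB.instance Definition _ := isGroup.Build (wreath A B)
  wr_mulA wr_mul1 wr_1mul wr_mulV wr_Vmul.

Definition wr_base (b : B) : wreath A B := (b, 0%R).
Definition wr_fun (f : {malg A[B]}) : wreath A B := (1, f).

Lemma wr_mulE p q : p * q = ((p.1 * q.1)%g, rtrans q.1 p.2 + q.2)%R.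
Proof. by []. Qed.

Lemma wr_invE p : p^-1 = ((p.1^-1)%g, - rtrans (p.1^-1)%g p.2)%R.
Proof. by []. Qed.

Lemma wr_baseM : {morph wr_base : b c / b * c}.
Proof. by move=> b c; rewrite wr_mulE /= rtrans0 addr0. Qed.

Lemma wr_funD f g : wr_fun (f + g)%R = wr_fun f * wr_fun g.
Proof. by rewrite wr_mulE /= rtrans1 mulg1. Qed.

Lemma wr_funJ b f : wr_fun f ^ wr_base b = wr_fun (rtrans b f).
Proof.
rewrite conjgE !wr_mulE wr_invE /=.
by rewrite mul1g mulVg !rtrans0 oppr0 rtrans0 addr0 add0r.
Qed.

End Wreath.

Section FoxCalculus.
Variable r : nat.
Local Notation F := (free_group r).
Variable i : 'I_r.

Definition fox_letter (l : letter r) : {malg int[F]} :=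
  if l.1 == i then
    (if l.2 then - << free_letter l >> else << (1 : F)%g >>)%R
  else 0%R.

(* d(l w) = (d l) w + d w, with d x_j = delta_ij and                           *)
(* d (x_j^-1) = - delta_ij x_j^-1.                                             *)
Fixpoint fox_word (w : seq (letter r)) : {malg int[F]} :=
  if w is l :: w' then (rtrans (of_word w') (fox_letter l) + fox_word w')%R
  else 0%R.

Definition fox (u : F) : {malg int[F]} := fox_word u.

Lemma fox_letterV l :
  (rtrans (free_letter l) (fox_letter (linv l)) + fox_letter l = 0)%R.
Proof.
rewrite /fox_letter; case: l => j b /=; case: eqP => _; last first.
  by rewrite rtrans0 addr0.
have e : free_letter (j, ~~ b) = (free_letter (j, b))^-1 by rewrite -free_letterV.
case: b e => /= e; rewrite ?rtransN rtransU ?mul1g ?addrN //.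
by rewrite /linv /= e mulVg addNr.
Qed.

Lemma fox_word_push l w : fox_word (push l w) = fox_word (l :: w).
Proof.
case: w => [|m w] //=; case: eqP => [->|//].
rewrite addrA [of_word (_ :: _)]/of_word big_cons rtransM -rtransD.
rewrite -/(of_word w); set m' := linv l; rewrite -[l in fox_letter l]linvK.
by rewrite fox_letterV rtrans0 add0r.
Qed.

Lemma fox_word_cat w1 w2 :
  fox_word (w1 ++ w2) =
  (rtrans (of_word w2) (fox_word w1) + fox_word w2)%R.
Proof.
elim: w1 => [|l w1 IHw] /=; first by rewrite rtrans0 add0r.
by rewrite IHw addrA rtransD -rtransM /of_word big_cat.
Qed.

Lemma foxM u v : fox (u * v) = (rtrans v (fox u) + fox v)%R.
Proof.
have -> : fox (u * v) = fox_word (u ++ v).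
  rewrite /fox /=; elim: (fword u) => //= l w IHw.
  rewrite fox_word_push /= IHw; congr (rtrans _ _ + _)%R.
  elim: w {IHw} => //= m w IHw; rewrite push_of_word /of_word !big_cons.
  by congr (_ * _); exact: IHw.
by rewrite fox_word_cat of_word_fword.
Qed.

Lemma fox_gen j : fox (free_gen j) = (if j == i then << (1 : F)%g >> else 0)%R.
Proof.
by rewrite /fox /= /of_word big_nil rtrans1 addr0.
Qed.

End FoxCalculus.

Definition map_ring (G H : groupType) (h : G -> H) (alpha : {malg int[G]}) :
    {malg int[H]} :=
  (\sum_(x <- msupp alpha) << alpha@_x *g h x >>)%R.

(* a^alpha, the product of the (a^(u_b))^b for alpha = sum_b u_b b. *)
Definition base_exp (A : zmodType) (B : groupType) (a : A)
    (alpha : {malg int[B]}) : {malg A[B]} :=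
  (\sum_(b <- msupp alpha) rtrans b << (a *~ alpha@_b) *g (1 : B)%g >>)%R.

Section MapExp.
Local Open Scope ring_scope.

Variables (G H : groupType) (h : G -> H).
Hypothesis hM : {morph h : x y / (x * y)%g}.

Let hU k v := << v *g h k >> : {malg int[H]}.

Let hU0 k : hU k 0 = 0. Proof. exact: monalgU0. Qed.

Let hUD k : {morph hU k : x y / x + y}. Proof. exact: monalgUD. Qed.

Lemma map_ringD : {morph map_ring h : f g / f + g}.
Proof.
exact: sum_msuppD hU0 hUD.
Qed.

Lemma map_ringU k v : map_ring h << v *g k >> = << v *g h k >>.
Proof.
exact: sum_msuppU hU0 k v.
Qed.

Lemma map_ring0 : map_ring h 0 = 0.
Proof. by rewrite /map_ring msupp0 big_seq_fset0. Qed.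

Lemma map_ring_rtrans x f :
  map_ring h (rtrans x f) = rtrans (h x) (map_ring h f).
Proof.
elim/malg_ind: f => [|f g IHf IHg|k v].
- by rewrite !(rtrans0, map_ring0).
- by rewrite !(rtransD, map_ringD) IHf IHg.
- by rewrite !(rtransU, map_ringU) hM.
Qed.

Variables (A : zmodType) (a : A).

Let eU (k : H) v := rtrans k << (a *~ v) *g (1 : H)%g >>.

Let eU0 k : eU k 0 = 0.
Proof. by rewrite /eU mulr0z monalgU0 rtrans0. Qed.

Let eUD k : {morph eU k : x y / x + y}.
Proof. by move=> x y; rewrite /eU mulrzDr monalgUD rtransD. Qed.

Lemma base_expD : {morph @base_exp A H a : f g / f + g}.
Proof.
exact: sum_msuppD eU0 eUD.
Qed.

Lemma base_expU (k : H) v : base_exp a << v *g k >> = << (a *~ v) *g k >>.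
Proof.
by rewrite /base_exp (sum_msuppU eU0) /eU rtransU mul1g.
Qed.

Lemma base_exp0 : base_exp a (0 : {malg int[H]}) = 0.
Proof. by rewrite /base_exp msupp0 big_seq_fset0. Qed.

Lemma base_exp_rtrans x (f : {malg int[H]}) :
  base_exp a (rtrans x f) = rtrans x (base_exp a f).
Proof.
elim/malg_ind: f => [|f g IHf IHg|k v].
- by rewrite !(rtrans0, base_exp0).
- by rewrite !(rtransD, base_expD) IHf IHg.
- by rewrite !(rtransU, base_expU).
Qed.

End MapExp.

Section WordLength.
Variables (G : groupType) (X : set G).

Definition is_word_of (n : nat) (g : G) : Prop :=
  exists w : seq G, [/\ size w = n, {in w, forall s, X s \/ X s^-1} &
    \prod_(s <- w) s = g].

(* The value 0 outside of the subgroup generated by X is a dummy. *)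
Definition word_length (g : G) : nat :=
  if pselect (exists n, `[< is_word_of n g >]) is left ex then ex_minn ex
  else 0.

Definition generates : Prop := forall g, exists n, is_word_of n g.

Lemma word_length_spec : generates -> forall g,
  is_word_of (word_length g) g /\
  forall n, is_word_of n g -> (word_length g <= n)%N.
Proof.
move=> gX g; rewrite /word_length; case: pselect => [ex|[]]; last first.
  by have [n Xn] := gX g; exists n; apply/asboolP.
case: ex_minnP => n /asboolP Xn minn; split=> // m Xm.
by apply: minn; apply/asboolP.
Qed.

Lemma words_subgroup : is_subgroup [set g | exists n, is_word_of n g].
Proof.
split=> [|x y [n [w [_ wX <-]]] [m [v [_ vX <-]]]] /=.
  by exists 0, [::]; rewrite big_nil.
exists (size (w ++ [seq s^-1 | s <- rev v])), (w ++ [seq s^-1 | s <- rev v]); split=> //.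
  move=> s; rewrite mem_cat => /orP[/wX //|/mapP[t]].
  by rewrite mem_rev => /vX Xt ->; rewrite invgK; case: Xt; [right|left].
by rewrite big_cat big_map prodgV revK.
Qed.

Lemma word_gen x : X x -> exists n, is_word_of n x.
Proof.
move=> Xx; exists 1%N, [:: x]; rewrite big_seq1; split=> // s.
by rewrite inE => /eqP ->; left.
Qed.

End WordLength.

Definition free_solvable (d r : nat) : Type :=
  quotient (derived_normal (free_group r) d).
HB.instance Definition _ d r := Group.on (free_solvable d r).

Section Solvable.
Variables d r : nat.

Definition to_solvable (u : free_group r) : free_solvable d r :=
  proj (derived_normal (free_group r) d) u.

Definition solv_gen (i : 'I_r) : free_solvable d r := to_solvable (free_gen i).

Lemma to_solvableM : {morph to_solvable : u v / u * v}.
Proof. exact: projM. Qed.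

Definition lamp (i : 'I_r) : 'rV[int]_r := delta_mx 0%R i.

(* The basis element a_i of Z^r, as the function with value a_i at 1. *)
Definition wr_lamp (i : 'I_r) : wreath 'rV[int]_r (free_solvable d r) :=
  wr_fun << lamp i *g 1%g >>%R.

Definition solv_gens : set (free_solvable d r) := range solv_gen.

Definition wr_gens : set (wreath 'rV[int]_r (free_solvable d r)) :=
  range (fun i => wr_base _ (solv_gen i)) `|` range wr_lamp.

Lemma to_solvableK g : to_solvable (repr g) = g.
Proof. exact: proj_repr. Qed.

Lemma to_solvable1 : to_solvable 1 = 1.
Proof. by []. Qed.

Lemma to_solvableV u : to_solvable u^-1 = (to_solvable u)^-1.
Proof. exact: proj_inv. Qed.

Lemma free_solvable_ind (H : set (free_solvable d r)) :
  is_subgroup H -> (forall i, H (solv_gen i)) -> forall g, H g.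
Proof.
move=> sH Hx g; rewrite -(to_solvableK g) -[repr g]of_word_fword.
elim: (fword _) => [|[i b] w IHw]; first by rewrite /of_word big_nil; apply: sH.1.
rewrite /of_word big_cons to_solvableM; apply: subgroupM => //.
case: b => //; last exact: Hx.
rewrite -[(i, true)]/(linv (i, false)) free_letterV to_solvableV.
by apply: subgroupV => //; apply: Hx.
Qed.

Lemma solv_gens_generate : generates solv_gens.
Proof.
apply: free_solvable_ind; first exact: words_subgroup.
by move=> i; apply: word_gen; exists i.
Qed.

Lemma lamp_ind (f : 'rV[int]_r -> Prop) : f 0%R ->
    (forall u v, f u -> f v -> f (u + v)%R) -> (forall u, f u -> f (- u)%R) ->
    (forall i, f (lamp i)) ->
  forall v, f v.
Proof.
move=> f0 fD fN fl v; rewrite [v]row_sum_delta.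
elim/big_rec: _ => [|i x _ fx]; first exact: f0.
apply: (fD) fx; have fn n : f (lamp i *+ n)%R.
  by elim: n => [|n IHn]; [rewrite mulr0n|rewrite mulrS; apply: fD].
rewrite -[delta_mx _ i]/(lamp i) -[v _ i]intz scaler_int.
case: (v _ i) => n; first exact: fn.
by rewrite NegzE mulrNz; apply: fN; exact: fn.
Qed.

Lemma wr_gens_generate : generates wr_gens.
Proof.
have sW := words_subgroup wr_gens; set H := [set g | _] in sW.
have Hb b : H (wr_base _ b).
  move: b; apply: free_solvable_ind => [|i]; last first.
    by apply: word_gen; left; exists i.
  split=> [|x y Hx Hy]; first exact: sW.1.
  have -> : wr_base 'rV[int]_r (x / y) = wr_base _ x / wr_base _ y.
    by rewrite wr_baseM; congr (_ * _); rewrite wr_invE /= rtrans0 oppr0.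
  exact: sW.2.
have HD f g : H (wr_fun f) -> H (wr_fun g) -> H (wr_fun (f + g)%R).
  by move=> Hf Hg; rewrite wr_funD; apply: subgroupM.
have HN f : H (wr_fun f) -> H (wr_fun (- f)%R).
  move=> Hf; have -> : wr_fun (- f)%R = (wr_fun f)^-1.
    by rewrite wr_invE /= invg1 rtrans1.
  exact: subgroupV.
suff Hf f : H (wr_fun f).
  move=> [b f]; have -> : (b, f) = wr_base _ b * wr_fun f.
    by rewrite wr_mulE /= mulg1 rtrans0 add0r.
  by apply: (subgroupM sW); [apply: Hb|apply: Hf].
elim/malg_ind: f => [|f g|k v]; [exact: sW.1|exact: HD|].
have -> : (<< v *g k >> = rtrans k << v *g (1 : free_solvable d r)%g >>)%R.
  by rewrite rtransU mul1g.
rewrite -wr_funJ conjgE; apply: subgroupM => //; first exact: subgroupV.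
apply: subgroupM => //.
pose f (v : 'rV[int]_r) := H (wr_fun << v *g (1 : free_solvable d r)%g >>%R).
have f0 : f 0%R by rewrite /f monalgU0; apply: sW.1.
have fD u u' : f u -> f u' -> f (u + u')%R by rewrite /f monalgUD; apply: HD.
have fl i : f (lamp i) by apply: word_gen; right; exists i.
have fN u : f u -> f (- u)%R by rewrite /f monalgUN; apply: HN.
exact: lamp_ind f f0 fD fN fl v.
Qed.

End Solvable.

Arguments solv_gens : clear implicits.
Arguments wr_gens : clear implicits.

Section Magnus.
Variables d r : nat.
Local Notation F := (free_group r).
Local Notation B := (free_solvable d.-1 r).
Local Notation A := 'rV[int]_r.

Definition magnus_exp (u : F) : {malg A[B]} :=
  (\sum_(i < r)
    base_exp (lamp i) (map_ring (@to_solvable d.-1 r) (fox i u)))%R.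

Definition magnus_free (u : F) : wreath A B :=
  wr_base A (to_solvable d.-1 u) * wr_fun (magnus_exp u).

(* By magnus_proj below the choice of a representative of g is irrelevant for  *)
(* d >= 1. For d = 0 the codomain and the map are dummies.                     *)
Definition magnus (g : free_solvable d r) : wreath A B := magnus_free (repr g).

Lemma magnus_expM u v :
  magnus_exp (u * v) =
  (rtrans (to_solvable d.-1 v) (magnus_exp u) + magnus_exp v)%R.
Proof.
have toM := @to_solvableM d.-1 r; rewrite /magnus_exp.
rewrite (big_morph _ (rtransD _) (rtrans0 _ _)) -big_split.
apply: eq_bigr => i _ /=.
by rewrite foxM map_ringD base_expD map_ring_rtrans // base_exp_rtrans.
Qed.

Lemma magnus_freeE u : magnus_free u = (to_solvable d.-1 u, magnus_exp u).
Proof. by rewrite /magnus_free wr_mulE /= mulg1 rtrans0 add0r. Qed.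

Lemma magnus_freeM : {morph magnus_free : u v / u * v}.
Proof.
by move=> u v; rewrite !magnus_freeE wr_mulE magnus_expM to_solvableM.
Qed.

Lemma magnus_free_gen i :
  magnus_free (free_gen i) = wr_base A (solv_gen d.-1 i) * wr_lamp d.-1 i.
Proof.
rewrite /magnus_free; congr (_ * wr_fun _).
rewrite /magnus_exp (bigD1 i) //= big1 ?addr0 => [|j ji]; last first.
  by rewrite fox_gen eq_sym (negPf ji) map_ring0 base_exp0.
by rewrite fox_gen eqxx map_ringU base_expU mulr1z.
Qed.

Lemma magnus_free1 : magnus_free 1 = 1.
Proof. by apply: (mulgI (magnus_free 1)); rewrite -magnus_freeM !mulg1. Qed.

Lemma magnus_freeV u : magnus_free u^-1 = (magnus_free u)^-1.
Proof.
by apply: (mulgI (magnus_free u)); rewrite -magnus_freeM !mulgV magnus_free1.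
Qed.

Lemma magnus_proj (u : F) : 0 < d -> magnus (to_solvable d u) = magnus_free u.
Proof.
move=> d0; suff ker v : @derived F d v -> magnus_free v = 1.
  have /projP/ker : to_solvable d u = to_solvable d (repr (to_solvable d u)).
    by rewrite to_solvableK.
  by rewrite magnus_freeM magnus_freeV => /mulg1_eq; rewrite invgK /magnus => ->.
move: v; rewrite derivedS // -/(_ `<=` [set v | magnus_free v = 1]).
apply: smallest_sub => [|z [x Nx [y Ny ->]]] /=.
  split=> [|x y /=]; first exact: magnus_free1.
  by rewrite magnus_freeM magnus_freeV => -> ->; rewrite invg1 mulg1.
have ker1 v : @derived F d.-1 v -> exists f, magnus_free v = wr_fun f.
  move=> Nv; have t1 : to_solvable d.-1 v = 1.
    apply/esym/projP; by rewrite invg1 mul1g.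
  by exists (magnus_exp v); rewrite magnus_freeE t1.
have [[f ef] [g eg]] := (ker1 _ Nx, ker1 _ Ny).
rewrite commgEl conjgE !(magnus_freeM, magnus_freeV) ef eg.
by rewrite -wr_funD addrC wr_funD !mulKg mulVg.
Qed.

Lemma magnusM : 0 < d -> {morph magnus : g h / g * h}.
Proof.
move=> d0 g h; rewrite -(to_solvableK g) -(to_solvableK h).
by rewrite -to_solvableM !magnus_proj // magnus_freeM.
Qed.

Lemma magnus_gen i : 0 < d ->
  magnus (solv_gen d i) = wr_base A (solv_gen d.-1 i) * wr_lamp d.-1 i.
Proof. by move=> d0; rewrite magnus_proj // magnus_free_gen. Qed.

End Magnus.

(* Main.v *)
From HB Require Import structures.
Require Import Defs.
From mathcomp Require Import all_boot all_order all_algebra.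
From mathcomp Require Import finmap monalg.
From mathcomp Require Import boolp classical_sets reals.
From mathcomp Require Import zify.

(** The Magnus embedding changes word lengths by a factor of at most 2 in each
    direction, so lambda = 2 and C = 0 will do.

    One bound is immediate: [magnus] is a homomorphism sending each x_i to
    x_i a_i, a word of length 2 ([word_length_magnus_le]).

    For the other bound, read words from right to left: a word in the letters
    x_i^(+-1) is then a walk in the graph on B = S_{d-1,r} whose edges join b to
    x_i b, and its image under the Magnus map records the endpoint of the walk
    and, as a function B -> Z^r, its flow, i.e. the signed number of passages
    through each edge ([magnus_free_of_word]).  A word of length n in the
    generators of the wreath product is likewise read as a walk w of the cursor
    together with a list S of steps, one for each lamp generator, each of them
    sharing a vertex with w; moreover |w| + |S| = n ([wreath_word_steps]).

    If this word represents [magnus g], then S has the flow of a walk v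
    representing g, and w has the same endpoints as v.  Hence the steps of S
    together with the reversed steps of w form a circulation meeting w, and all
    of them can be inserted into w as detours, as in the construction of an
    Euler circuit ([euler_trail]).  The resulting walk has length
    2 |w| + |S| <= 2n; its own copy of w cancels the reversed one in the flow,
    so that it has the endpoint and the flow of v ([reroute]).

    The walk thus represents g, provided that endpoint and flow determine an
    element of F/N' ([magnus_inj]).  To see this, choose a representative s(b)
    of each b in B.  The elements s(x_i b)^-1 x_i s(b) lie in the abelian group
    N/N', and multiplying them along a walk from 1 to b spelled by u
    telescopes to s(b)^-1 u s(1); as N/N' is abelian, the product depends only
    on the flow of the walk. *)

Set Implicit Arguments.
Unset Strict Implicit.
Unset Printing Implicit Defensive.

Import Order.TTheory GRing.Theory Num.Theory.

Local Open Scope ring_scope.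

(** * Walks and Euler trails in labelled graphs *)

Section Trails.
Variables (L V : eqType) (act : L -> V -> V).
Implicit Types (w p q : seq L) (s : L * V) (S : seq (L * V)) (a b v : V).

(** A pair (l, b) is the step that the letter l makes from the vertex b.  Words
    act from the right end, like products of group elements. *)
Definition head s := act s.1 s.2.

Definition endpoint w b := foldr act b w.

Fixpoint steps w b : seq (L * V) :=
  if w is l :: w' then (l, endpoint w' b) :: steps w' b else [::].

Fixpoint vertices w b : seq V :=
  if w is l :: w' then endpoint w b :: vertices w' b else [:: b].

Lemma endpoint_cat p q b : endpoint (p ++ q) b = endpoint p (endpoint q b).
Proof. exact: foldr_cat. Qed.

Lemma steps_cat p q b : steps (p ++ q) b = steps p (endpoint q b) ++ steps q b.
Proof. by elim: p => //= l p ->; rewrite endpoint_cat. Qed.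

Lemma endpoint_vertices w b : endpoint w b \in vertices w b.
Proof. by case: w => [|l w]; rewrite /= mem_head. Qed.

Lemma mem_vertices_cat p q b v :
  (v \in vertices (p ++ q) b) =
  (v \in vertices p (endpoint q b)) || (v \in vertices q b).
Proof.
elim: p => [|l p IHp] /=; last by rewrite !in_cons endpoint_cat IHp orbA.
by rewrite inE; case: eqP => // ->; rewrite endpoint_vertices.
Qed.

Lemma vertices_split w b v : v \in vertices w b ->
  exists p q, w = p ++ q /\ endpoint q b = v.
Proof.
elim: w => [|l w IHw] /=; first by rewrite inE => /eqP ->; exists [::], [::].
rewrite inE => /predU1P[->|/IHw[p [q [-> <-]]]]; first by exists [::], (l :: w).
by exists (l :: p), q.
Qed.

Lemma size_steps w b : size (steps w b) = size w.
Proof. by elim: w => //= l w ->. Qed.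

Lemma steps_vertices w b s : s \in steps w b ->
  (s.2 \in vertices w b) && (head s \in vertices w b).
Proof.
elim: w => //= l w IHw; rewrite !in_cons => /predU1P[->|/IHw /andP[-> ->]].
  by rewrite /= endpoint_vertices /head /= eqxx orbT.
by rewrite !orbT.
Qed.

Lemma telescope_steps (W : zmodType) (h : V -> W) w b :
  \sum_(s <- steps w b) (h (head s) - h s.2) = h (endpoint w b) - h b.
Proof.
elim: w => [|l w IHw] /=; first by rewrite big_nil subrr.
by rewrite big_cons IHw /head /= addrA subrK.
Qed.

(** The boundary of S is b - a, tested against integer potentials. *)
Definition flows_from S a b := forall h : V -> int,
  \sum_(s <- S) (h (head s) - h s.2) = h b - h a.

Definition touches (vs : seq V) s := (s.2 \in vs) || (head s \in vs).

(** Testing against the indicator function of v: if no step leaves v, then only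
    arrivals contribute, and they are counted by the boundary at v. *)
Lemma no_departure S a b v : flows_from S a b -> ~~ has (fun s => s.2 == v) S ->
  (count (fun s => head s == v) S)%:Z = (b == v)%:Z - (a == v)%:Z.
Proof.
move=> /(_ (fun x => (x == v)%:Z)) <-.
elim: S => [|s S IHS] /=; first by rewrite big_nil.
by rewrite negb_or big_cons => /andP[/negPf -> /IHS <-]; lia.
Qed.

Lemma flows_from_rem S a b s : s \in S -> s.2 = a ->
  flows_from S a b -> flows_from (rem s S) (head s) b.
Proof.
move=> sS <- fS h; apply: (addrI (h (head s) - h s.2)).
have := fS h; rewrite (perm_big _ (perm_to_rem sS)) big_cons /= => ->.
by lia.
Qed.

(** Hierholzer's algorithm.  The walk under construction is p2 after p1; it has
    a gap, since p1 arrives at one vertex and p2 leaves from another one, v, and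
    the steps of S, to be used exactly once each, can lead across that gap.  If
    some step of S leaves the end of p1, it is appended to p1.  Otherwise
    conservation closes the gap, and the walk is cut again at one of its
    vertices where a step of S is still available. *)
Lemma euler_trail S p2 p1 b v : flows_from S (endpoint p1 b) v ->
    {in S, forall s, touches (vertices p2 v ++ vertices p1 b) s} ->
  exists2 w, endpoint w b = endpoint p2 v &
    perm_eq (steps w b) (steps p2 v ++ S ++ steps p1 b).
Proof.
have [n] := ubnP (size S); elim: n => // n IHn in S p2 p1 v *.
rewrite ltnS => leSn flowS touchS.
(* The cut (q2, q1) may differ from (p2, p1): it is a new one when the gap is
   closed. *)
have extend q2 q1 a s : s \in S -> s.2 = endpoint q1 b ->
    flows_from S (endpoint q1 b) a ->
    {subset vertices p2 v ++ vertices p1 b <= vertices q2 a ++ vertices q1 b} ->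
  exists2 w, endpoint w b = endpoint q2 a &
    perm_eq (steps w b) (steps q2 a ++ S ++ steps q1 b).
  move=> sS tail_s flow sub.
  have [|||w ew perm_w] := IHn (rem s S) q2 (s.1 :: q1) a.
  - by rewrite size_rem //; case: (S) sS leSn.
  - by rewrite /= -tail_s; apply: flows_from_rem flow.
  - move=> t /mem_rem /touchS; rewrite /touches => /orP[] /sub;
      rewrite !mem_cat /= !in_cons => /orP[] ->; by rewrite ?orbT.
  exists w => //; apply: perm_trans perm_w _.
  rewrite perm_cat2l /= -tail_s -surjective_pairing perm_sym.
  apply: (@perm_trans _ ((s :: rem s S) ++ steps q1 b)).
    by rewrite perm_cat2r perm_to_rem.
  by rewrite -[_ :: steps _ _]cat1s -cat1s -catA perm_catCA.
have [/hasP[s sS /eqP tail_s]|nodep] :=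
  boolP (has (fun s => s.2 == endpoint p1 b) S); first exact: extend tail_s _ _.
have ev : endpoint p1 b = v.
  by have := no_departure flowS nodep; rewrite eqxx; case: eqP => // _; lia.
case def_S: S => [|s S'].
  by exists (p2 ++ p1); rewrite ?endpoint_cat ?steps_cat ev.
rewrite -def_S; have sS : s \in S by rewrite def_S mem_head.
(* A step that merely arrives at x does not help by itself, but conservation
   then yields another one leaving x. *)
have [x xp dep] : exists2 x, x \in vertices (p2 ++ p1) b &
    has (fun s => s.2 == x) S.
  have := touchS s sS; rewrite /touches !mem_cat -{1 2}ev -!mem_vertices_cat.
  case/orP=> xp; [exists s.2 => //; by apply/hasP; exists s|exists (head s) => //].
  apply/negPn/negP => /(no_departure flowS); rewrite ev subrr => /eqP.
  by rewrite eqz_nat => /eqP/eqP; rewrite -leqn0 leqNgt -has_count => /hasP[]; exists s.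
have [q2 [q1 [eq_pq eq1]]] := vertices_split xp.
have /hasP[t tS /eqP tail_t] := dep.
have [|||w ew perm_w] := extend q2 q1 x t tS.
- by rewrite eq1.
- by move=> h; rewrite flowS eq1 ev !subrr.
- by move=> y; rewrite !mem_cat -{1}ev -mem_vertices_cat eq_pq mem_vertices_cat eq1.
exists w; first by rewrite ew -eq1 -endpoint_cat -eq_pq endpoint_cat ev.
apply: perm_trans perm_w _.
rewrite perm_catCA -eq1 -steps_cat -eq_pq steps_cat ev perm_catCA.
exact: perm_refl.
Qed.

End Trails.

(** * Flows in the Cayley graph *)

Section BaseGroup.
Variables (r : nat) (B : groupType) (x : letter r -> B).
Hypothesis xV : forall l, x (linv l) = (x l)^-1%g.
Local Notation A := 'rV[int]_r.
Implicit Types (s : letter r * B) (S : seq (letter r * B)) (w : seq (letter r)).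

Definition cayley (l : letter r) (b : B) : B := (x l * b)%g.

Definition edge (e : 'I_r * B) : {malg A[B]} := << lamp e.1 *g e.2 >>.

(** The pair (i, b) names the edge from b to x_i b.  A step spelled x_i crosses
    the edge named after its tail; a step spelled x_i^-1 crosses, backwards, the
    edge named after its head. *)
Definition weight (W : zmodType) (e : 'I_r * B -> W) s : W :=
  if s.1.2 then - e (s.1.1, head cayley s) else e (s.1.1, s.2).

Definition flow S : {malg A[B]} := \sum_(s <- S) weight edge s.

Lemma cayleyK l : cancel (cayley l) (cayley (linv l)).
Proof. by move=> b; rewrite /cayley xV mulKg. Qed.

Definition reverse_step s := (linv s.1, head cayley s).

Lemma head_reverse s : head cayley (reverse_step s) = s.2.
Proof. exact: cayleyK. Qed.

Lemma weight_reverse (W : zmodType) (e : 'I_r * B -> W) s :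
  weight e (reverse_step s) = - weight e s.
Proof.
by rewrite /weight head_reverse; case: s => [[i []] b] /=; rewrite ?opprK.
Qed.

Section Pairing.
Variables (W : zmodType) (e : 'I_r * B -> W).

(** The additive extension of e from edges to finitely supported functions
    B -> Z^r, which are the formal integral combinations of edges. *)
Definition pairing (f : {malg A[B]}) : W :=
  \sum_(b <- msupp f) \sum_(i < r) e (i, b) *~ f@_b ord0 i.

Let term (b : B) (v : A) := \sum_(i < r) e (i, b) *~ v ord0 i.

Let term0 b : term b 0 = 0.
Proof. by rewrite /term big1 // => i _; rewrite mxE mulr0z. Qed.

Let termD b : {morph term b : u v / u + v}.
Proof.
move=> u v; rewrite /term -big_split; apply: eq_bigr => i _.
by rewrite mxE mulrzDr.
Qed.

Lemma pairingD : {morph pairing : f g / f + g}.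
Proof. exact: sum_msuppD term0 termD. Qed.

Lemma pairing0 : pairing 0 = 0.
Proof. by rewrite /pairing msupp0 big_seq_fset0. Qed.

Lemma pairingN f : pairing (- f) = - pairing f.
Proof. by apply: (addrI (pairing f)); rewrite -pairingD !subrr pairing0. Qed.

Lemma pairing_edge k : pairing (edge k) = e k.
Proof.
case: k => i b; rewrite /pairing (sum_msuppU term0) /term (bigD1 i) //= big1.
  by rewrite mxE !eqxx mulr1z addr0.
by move=> j /negPf ji; rewrite mxE ji andbF mulr0z.
Qed.

Lemma pairing_flow S : pairing (flow S) = \sum_(s <- S) weight e s.
Proof.
rewrite /flow (big_morph _ pairingD pairing0); apply: eq_bigr => s _.
by rewrite /weight; case: ifP => _; rewrite ?pairingN pairing_edge.
Qed.

End Pairing.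

Lemma rtrans_weight l b c :
  rtrans c (weight edge (l, b)) = weight edge (l, (b * c)%g).
Proof.
by case: l => i [|]; rewrite /weight /edge /head /cayley /= ?rtransN rtransU ?mulgA.
Qed.

(** Everything additive that can be read off the steps of a walk is a function
    of its flow. *)
Lemma weight_universal (W : zmodType) (e : 'I_r * B -> W) S S' :
    flow S = flow S' ->
  \sum_(s <- S) weight e s = \sum_(s <- S') weight e s.
Proof. by move=> eqS; rewrite -(pairing_flow e S) eqS pairing_flow. Qed.

(** Makes the boundary of a list of steps an instance of [weight_universal]. *)
Lemma weight_gradient (W : zmodType) (h : B -> W) s :
  weight (fun k => h (x (k.1, false) * k.2)%g - h k.2) s =
  h (head cayley s) - h s.2.
Proof.
case: s => [[i []] b] //; rewrite /weight /= opprB.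
by rewrite -[(i, false)]/(linv (i, true)) [(_ * _)%g]cayleyK.
Qed.

(** The walk v may be much longer than w and S.  The detours inserted into
    w are S and the reversed steps of w itself: the latter make the whole a
    circulation and cancel w in the flow. *)
Lemma reroute S w v b :
    flow S = flow (steps cayley v b) ->
    endpoint cayley w b = endpoint cayley v b ->
    {in S, forall s, touches cayley (vertices cayley w b) s} ->
  exists u, [/\ size u = (size S + 2 * size w)%N,
    endpoint cayley u b = endpoint cayley v b &
    flow (steps cayley u b) = flow (steps cayley v b)].
Proof.
move=> flow_S end_w touchS.
pose C := S ++ [seq reverse_step s | s <- steps cayley w b].
have circC : flows_from cayley C (endpoint cayley w b) (endpoint cayley w b).
  move=> h; rewrite subrr big_cat big_map /=.
  have := weight_universal (fun k => h (x (k.1, false) * k.2)%g - h k.2) flow_S.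
  rewrite !(eq_bigr _ (fun s _ => weight_gradient h s)) telescope_steps => ->.
  rewrite -end_w -telescope_steps -big_split big1 //= => s _.
  by rewrite head_reverse /reverse_step /= addrC subrKA subrr.
have [|u end_u perm_u] := euler_trail (p2 := [::]) circC.
  move=> s; rewrite mem_cat /touches mem_cat => /orP[/touchS|/mapP[t tw ->]].
    by rewrite /touches !mem_cat => /orP[] ->; rewrite !orbT.
  have /andP[_ ht] := steps_vertices tw.
  by rewrite [reverse_step _]/reverse_step /= ht orbT.
exists u; split.
- rewrite -(size_steps cayley u b) (perm_size perm_u) /= !size_cat size_map size_steps.
  by rewrite -addnA mul2n addnn.
- by rewrite end_u end_w.
- rewrite /flow (perm_big _ perm_u) /= !big_cat big_map /= -addrA.
  rewrite -[RHS]addr0 -[\sum_(s <- steps _ v _) _]flow_S.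
  congr (_ + _); rewrite -big_split big1 //= => s _.
  by rewrite weight_reverse addNr.
Qed.

End BaseGroup.

(** * Magnus images as endpoint and flow *)

Section LetterImage.
Variables d r : nat.
Local Notation B := (free_solvable d r).
Implicit Types (w : seq (letter r)).

Definition letter_image (l : letter r) : B := to_solvable d (free_letter l).

Lemma letter_imageV l : letter_image (linv l) = (letter_image l)^-1%g.
Proof. by rewrite /letter_image free_letterV to_solvableV. Qed.

Local Notation act := (cayley letter_image).

Lemma of_word_cons l w : of_word (l :: w) = (free_letter l * of_word w)%g.
Proof. by rewrite /of_word big_cons. Qed.

Lemma endpoint_of_word w : endpoint act w 1%g = to_solvable d (of_word w).
Proof.
elim: w => [|l w IHw] /=; first by rewrite /of_word big_nil.
by rewrite IHw of_word_cons to_solvableM.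
Qed.

End LetterImage.

Section MagnusFlow.
Variables d r : nat.
Implicit Types (w : seq (letter r)).
Local Notation x := (letter_image d.-1 (r := r)).
Local Notation act := (cayley x).

Lemma magnus_free_letter l :
  magnus_free d (free_letter l) = (x l, weight x (@edge r _) (l, 1%g)).
Proof.
have gen i : magnus_free d (free_gen i) = (x (i, false), << lamp i *g 1%g >>).
  rewrite magnus_free_gen wr_mulE /= rtrans0 add0r; congr (_, _).
  exact: mulg1.
case: l => i [|]; last exact: gen.
rewrite -[(i, true)]/(linv (i, false)) free_letterV magnus_freeV gen wr_invE /=.
rewrite letter_imageV rtransU mul1g.
by rewrite /weight /edge /head /= /cayley letter_imageV mulg1.
Qed.

(** The recursion defining the Fox derivatives, d(l w) = (d l) w + d w, adds the
    step (l, w) to the flow. *)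
Lemma magnus_free_of_word w :
  magnus_free d (of_word w) =
  (to_solvable d.-1 (of_word w), flow x (steps act w 1%g)).
Proof.
rewrite /flow; elim: w => [|l w IHw].
  rewrite big_nil /of_word big_nil magnus_free1 to_solvable1; reflexivity.
rewrite of_word_cons magnus_freeM IHw [steps _ _ _]/= big_cons.
rewrite magnus_free_letter wr_mulE [X in X = _]/= to_solvableM endpoint_of_word.
by congr (_, _ + _); rewrite rtrans_weight mul1g.
Qed.

End MagnusFlow.

(** * Abelian subgroups as additive groups *)

Section AbelianSubgroup.
Variables (G : groupType) (M : set G).
Hypotheses (sM : is_subgroup M).
Hypothesis (cM : forall x y : G, M x -> M y -> (x * y = y * x)%g).

(** The proofs of closure and commutativity are parameters of the type, so that
    the additive structure can be attached to it. *)
Definition abelian_subgroup of is_subgroup M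
  & (forall x y : G, M x -> M y -> (x * y = y * x)%g) : Type :=
  {x : G | `[< M x >]}.
Local Notation U := (abelian_subgroup sM cM).

HB.instance Definition _ := Choice.on U.

Let mem (u : U) : M (val u). Proof. by case: u => u /= /asboolP. Qed.

Definition ab_in u (Mu : M u) : U := exist _ u (introT (asboolP _) Mu).
Definition ab_val (u : U) : G := val u.

Definition ab_zero : U := ab_in sM.1.
Definition ab_add (u v : U) : U := ab_in (subgroupM sM (mem u) (mem v)).
Definition ab_opp (u : U) : U := ab_in (subgroupV sM (mem u)).

Fact ab_addA : associative ab_add.
Proof. by move=> u v w; apply: val_inj; exact: mulgA. Qed.

Fact ab_addC : commutative ab_add.
Proof. by move=> u v; apply: val_inj; apply: cM; exact: mem. Qed.

Fact ab_add0 : left_id ab_zero ab_add.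
Proof. by move=> u; apply: val_inj; exact: mul1g. Qed.

Fact ab_addN : left_inverse ab_zero ab_opp ab_add.
Proof. by move=> u; apply: val_inj; exact: mulVg. Qed.

HB.instance Definition _ :=
  GRing.isZmodule.Build U ab_addA ab_addC ab_add0 ab_addN.

Lemma ab_inK u (Mu : M u) : ab_val (ab_in Mu) = u. Proof. by []. Qed.
Lemma ab_val0 : ab_val 0 = 1%g. Proof. by []. Qed.
Lemma ab_valD u v : ab_val (u + v) = (ab_val u * ab_val v)%g. Proof. by []. Qed.

End AbelianSubgroup.

(** * Injectivity of the Magnus embedding *)

Section Injectivity.
Variables d r : nat.
Hypothesis d_gt0 : (0 < d)%N.
Local Notation F := (free_group r).
Local Notation B := (free_solvable d.-1 r).
Local Notation x := (letter_image d.-1 (r := r)).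
Local Notation act := (cayley x).
Local Notation N := (@derived F d.-1).

(** The image N/N' of N in F/N'. *)
Definition relations : set (free_solvable d r) :=
  [set g | exists2 u : F, N u & g = to_solvable d u].

Lemma relations_subgroup : is_subgroup relations.
Proof.
have [sN _] := derived_normal F d.-1; split=> [|g h [u Nu ->] [v Nv ->]].
  by exists 1%g; [exact: sN.1|].
by exists (u / v)%g; [exact: sN.2|rewrite to_solvableM to_solvableV].
Qed.

Lemma to_solvable_eq n (u v : F) :
  @derived F n (u^-1 * v)%g -> to_solvable n u = to_solvable n v.
Proof. by move=> ?; apply/projP. Qed.

Lemma relations_abelian g h : relations g -> relations h -> (g * h = h * g)%g.
Proof.
move=> [u Nu ->] [v Nv ->]; rewrite -!to_solvableM; apply/esym/to_solvable_eq.
rewrite derivedS //; apply: sub_gen_smallest; exists u => //; exists v => //.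
by rewrite commgEl conjgE invgM !mulgA.
Qed.

Lemma to_solvable_ker n (u : F) : to_solvable n u = 1%g -> @derived F n u.
Proof. by rewrite -(to_solvable1 n r) => /esym/projP; rewrite invg1 mul1g. Qed.

Lemma relation_of_step (s : letter r * B) :
  relations (to_solvable d ((repr (head act s))^-1 * (free_letter s.1 * repr s.2)))%g.
Proof.
exists ((repr (head act s))^-1 * (free_letter s.1 * repr s.2))%g => //.
apply: to_solvable_ker; rewrite !to_solvableM to_solvableV !to_solvableK.
exact: mulVg.
Qed.

(* N/N', written additively. *)
Local Notation M := (abelian_subgroup relations_subgroup relations_abelian).

(** With s(b) the canonical representative of b, these are the Schreier
    generators s(l b)^-1 l s(b) of N, taken modulo N'. *)
Definition step_relation (s : letter r * B) : M := ab_in _ _ (relation_of_step s).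

Definition edge_relation (k : 'I_r * B) : M :=
  step_relation ((k.1, false), k.2).

(** Reversing a step inverts its relation, so that the relations of all steps
    are determined by those of the edges. *)
Lemma weight_relation s : weight x edge_relation s = step_relation s.
Proof.
case: s => [[i []] b] //; rewrite /weight /=; apply: val_inj.
rewrite -[LHS]/(_^-1)%g /= -to_solvableV; congr to_solvable.
have -> : head act (i, false, head act (i, true, b)) = b.
  by rewrite -[(i, false)]/(linv (i, true)) /head /= cayleyK //; exact: letter_imageV.
by rewrite -[(i, true)]/(linv (i, false)) !free_letterV !invgM invgK mulgA.
Qed.

(** The representatives at the inner vertices of the walk cancel. *)
Lemma sum_step_relation w :
  ab_val (\sum_(s <- steps act w 1%g) step_relation s) =
  to_solvable d ((repr (endpoint act w 1))^-1 * (of_word w * repr (1 : B)))%g.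
Proof.
elim: w => [|l w IHw] /=.
  by rewrite big_nil /of_word big_nil mul1g mulVg.
rewrite big_cons ab_valD IHw ab_inK -to_solvableM of_word_cons; congr to_solvable.
by rewrite /head /= -!mulgA; congr (_ * (_ * _))%g; rewrite mulVKg.
Qed.

(** If flow and endpoint are trivial, then the product computed by
    [sum_step_relation] is trivial and equals s(1)^-1 u s(1). *)
Lemma magnus_inj : injective (@magnus d r).
Proof.
suff ker (u : F) : magnus_free d u = 1%g -> to_solvable d u = 1%g.
  move=> g h eq_gh; rewrite -(to_solvableK g) -(to_solvableK h).
  apply: (mulgI (to_solvable d (repr g))^-1%g).
  rewrite mulVg -to_solvableV -to_solvableM.
  apply/esym/ker; rewrite magnus_freeM magnus_freeV -[magnus_free d (repr h)]eq_gh.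
  exact: mulVg.
rewrite -[u]of_word_fword; move: (fword u) => w.
rewrite magnus_free_of_word => ker_w.
have end_w : to_solvable d.-1 (of_word w) = 1%g := congr1 fst ker_w.
have flow_w : flow x (steps act w 1%g) = flow x [::].
  by rewrite [RHS]big_nil; exact: (congr1 (fun p : wreath 'rV[int]_r B => p.2) ker_w).
have := sum_step_relation w.
rewrite (eq_bigr (weight x edge_relation)) => [|s _]; last by rewrite weight_relation.
rewrite (weight_universal edge_relation flow_w) big_nil endpoint_of_word end_w.
rewrite ab_val0 !to_solvableM to_solvableV => /esym.
set a := to_solvable d (repr (1%g : B)); set b := to_solvable d (of_word w) => ab1.
by apply: (mulIg a); apply: (mulgI a^-1%g); rewrite ab1 mul1g mulVg.
Qed.

End Injectivity.

(** * Words of the wreath product *)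

Section WreathWords.
Variables d r : nat.
Local Notation B := (free_solvable d r).
Local Notation x := (letter_image d (r := r)).
Local Notation act := (cayley x).
Implicit Types (t p : wreath 'rV[int]_r B).

(** A base generator moves the cursor p.1 along an edge; a lamp generator a_i
    adds the edge (i, p.1) to the flow p.2.  As a step, a_i^-1 crosses this edge
    backwards: it ends at the cursor instead of starting there. *)
Lemma wr_gens_mul t p : wr_gens d r t \/ wr_gens d r t^-1%g ->
  (exists l, (t * p)%g = (act l p.1, p.2)) \/
  (exists2 s, s.2 = p.1 \/ head act s = p.1 &
     (t * p)%g = (p.1, weight x (@edge r B) s + p.2)).
Proof.
move=> gen_t; rewrite wr_mulE; case: gen_t => [gen_t|].
  case: gen_t => -[i _ <-].
    by left; exists (i, false); rewrite /= rtrans0 add0r.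
  right; exists ((i, false), p.1); first by left.
  by rewrite /= mul1g rtransU mul1g.
rewrite -[in X in _ -> X](invgK t) => -[] [i _ <-]; rewrite wr_invE /=.
  left; exists (i, true); rewrite rtrans0 oppr0 rtrans0 add0r.
  by rewrite -[(i, true)]/(linv (i, false)) /cayley letter_imageV.
have headE : head act ((i, true), act (i, false) p.1) = p.1.
  exact: (cayleyK (@letter_imageV d r) (i, false)).
right; exists ((i, true), act (i, false) p.1); first by right.
by rewrite /weight headE /= invg1 mul1g rtrans1 rtransN rtransU mul1g.
Qed.

Lemma wreath_word_steps (ts : seq (wreath 'rV[int]_r B)) :
    {in ts, forall t, wr_gens d r t \/ wr_gens d r t^-1%g} ->
  exists w S, [/\ (size w + size S = size ts)%N,
    (\prod_(t <- ts) t)%g = (endpoint act w 1%g, flow x S) &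
    {in S, forall s, touches act (vertices act w 1%g) s}].
Proof.
elim: ts => [|t ts IHts] gen_ts; first by exists [::], [::]; rewrite /flow !big_nil.
have [|w [S [size_wS prod_ts touchS]]] := IHts.
  by move=> t' ts_t'; apply: gen_ts; rewrite inE ts_t' orbT.
rewrite big_cons prod_ts.
have [[l ->]|[s tip_s ->]] :=
  wr_gens_mul (endpoint act w 1%g, flow x S) (gen_ts t (mem_head _ _)).
  exists (l :: w), S; split=> [|//|s /touchS]; first by rewrite /= addSn size_wS.
  by rewrite /touches /= !inE => /orP[] ->; rewrite !orbT.
exists w, (s :: S); split=> [||s'].
- by rewrite /= addnS size_wS.
- by rewrite /flow big_cons.
- rewrite inE => /predU1P[->|/touchS //]; rewrite /touches.
  by case: tip_s => ->; rewrite endpoint_vertices ?orbT.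
Qed.

End WreathWords.

(** * Comparison of word lengths *)

Lemma word_length_le (G : groupType) (X : set G) n g :
  generates X -> is_word_of X n g -> (word_length X g <= n)%N.
Proof. by move=> gX Xn; have [_] := word_length_spec gX g; apply. Qed.

Lemma is_word_of_to_solvable d r (w : seq (letter r)) :
  is_word_of (solv_gens d r) (size w) (to_solvable d (of_word w)).
Proof.
exists [seq to_solvable d (free_letter l) | l <- w]; split.
- exact: size_map.
- move=> _ /mapP[[i b] _ ->]; case: b; last by left; exists i.
  right; exists i => //.
  by rewrite -[(i, true)]/(linv (i, false)) free_letterV to_solvableV invgK.
- rewrite big_map; elim: w => [|l w IHw]; first by rewrite /of_word !big_nil.
  by rewrite big_cons IHw of_word_cons to_solvableM.
Qed.

Lemma magnus1 d r : (0 < d)%N -> magnus (1%g : free_solvable d r) = 1%g.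
Proof. by move=> d0; rewrite -(to_solvable1 d r) (magnus_proj _ d0) magnus_free1. Qed.

Lemma magnusV d r (g : free_solvable d r) :
  (0 < d)%N -> magnus g^-1%g = (magnus g)^-1%g.
Proof.
move=> d0; apply: (mulgI (magnus g)).
by rewrite -(magnusM d0) (mulgV g) (mulgV (magnus g)) (magnus1 _ d0).
Qed.

Lemma word_length_magnus_le d r (g : free_solvable d r) : (0 < d)%N ->
  (word_length (wr_gens d.-1 r) (magnus g)
     <= 2 * word_length (solv_gens d r) g)%N.
Proof.
move=> d_gt0; apply: word_length_le; first exact: wr_gens_generate.
have [[s [<- gen_s <-]] _] := word_length_spec (@solv_gens_generate d r) g.
elim: s gen_s => [|t s IHs] gen_s; first by exists [::]; rewrite !big_nil (magnus1 _ d_gt0).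
have [t' ts|W [sz gen_W prod_W]] := IHs; first by apply: gen_s; rewrite inE ts orbT.
rewrite big_cons (magnusM d_gt0) -prod_W.
have [|] := gen_s t (mem_head _ _) => -[i _ eq_t].
  exists [:: wr_base _ (solv_gen d.-1 i), wr_lamp d.-1 i & W]; split.
  - by rewrite /= sz mulnS.
  - move=> u; rewrite !inE => /or3P[/eqP->|/eqP->|/gen_W //]; left;
      [by left; exists i|by right; exists i].
  - rewrite -eq_t (magnus_gen i d_gt0) !big_cons.
    exact: mulgA.
exists [:: (wr_lamp d.-1 i)^-1, (wr_base _ (solv_gen d.-1 i))^-1 & W]%g; split.
- by rewrite /= sz mulnS.
- move=> u; rewrite !inE => /or3P[/eqP->|/eqP->|/gen_W //]; right; rewrite invgK;
    [by right; exists i|by left; exists i].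
- rewrite -[t]invgK -eq_t (magnusV _ d_gt0) (magnus_gen i d_gt0) invgM !big_cons.
  exact: mulgA.
Qed.

Lemma word_length_le_magnus d r (g : free_solvable d r) : (0 < d)%N ->
  (word_length (solv_gens d r) g
     <= 2 * word_length (wr_gens d.-1 r) (magnus g))%N.
Proof.
move=> d_gt0.
have [[s [<- gen_s prod_s]] _] := word_length_spec (@wr_gens_generate d.-1 r) (magnus g).
have [w [S [sz prod_wS touchS]]] := wreath_word_steps gen_s.
set x := letter_image d.-1 (r := r) in prod_wS touchS.
have xV : forall l, x (linv l) = (x l)^-1%g := @letter_imageV d.-1 r.
(* An arbitrary word for g: only its endpoint and its flow are used. *)
pose v := fword (repr g).
have magnus_v : magnus g = magnus_free d (of_word v) by rewrite of_word_fword.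
have eq_wv : (endpoint (cayley x) w 1%g, flow x S) =
             (endpoint (cayley x) v 1%g, flow x (steps (cayley x) v 1%g)).
  by rewrite -prod_wS prod_s magnus_v magnus_free_of_word endpoint_of_word.
have end_wv : endpoint (cayley x) w 1%g = endpoint (cayley x) v 1%g := congr1 fst eq_wv.
have flow_Sv : flow x S = flow x (steps (cayley x) v 1%g) := congr1 snd eq_wv.
have [u [sz_u end_u flow_u]] := reroute xV flow_Sv end_wv touchS.
have <- : to_solvable d (of_word u) = g.
  apply: (magnus_inj d_gt0); rewrite (magnus_proj _ d_gt0) magnus_v.
  rewrite !magnus_free_of_word -!endpoint_of_word flow_u end_u.
  reflexivity.
apply: leq_trans (word_length_le (@solv_gens_generate d r) (is_word_of_to_solvable d u)) _.
rewrite sz_u -sz mulnDr addnC leq_add2l.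
by rewrite leq_pmull.
Qed.

Theorem corollary4 (R : realType) (r d : nat) (hr : (1 <= r)%N) (hd : (1 <= d)%N) :
  exists lambda C : R, [/\ 1 <= lambda, 0 <= C &
    forall g h : free_solvable d r,
      lambda^-1 * (word_length (solv_gens d r) (g^-1 * h)%g)%:R - C
        <= (word_length (wr_gens d.-1 r) ((magnus g)^-1 * magnus h)%g)%:R
        <= lambda * (word_length (solv_gens d r) (g^-1 * h)%g)%:R + C].
Proof.
exists 2%:R, 0; split=> // [|g h]; first by rewrite ler1n.
have -> : ((magnus g)^-1 * magnus h)%g = magnus (g^-1 * h)%g.
  by apply: (mulgI (magnus g)); rewrite -(magnusM hd) !mulVKg.
rewrite subr0 addr0 ler_pdivrMl ?ltr0n // -!natrM !ler_nat.
by rewrite word_length_le_magnus // word_length_magnus_le.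
Qed.
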